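(* Let $G_1=(V_1,E_1)$ and $G_2=(V_2,E_2)$ be two graphs with disjoint vertex sets, $x_1y_1\in E_1$ and $x_2y_2\in E_2$. Then for the Haj\'os sum $G_3=G_1(x_1y_1)+_H G_2(x_2y_2)$ it holds that $$\gamma_{sp}(G_1)+\gamma_{sp}(G_2)-2\leq\gamma_{sp}(G_3)\leq\gamma_{sp}(G_1)+\gamma_{sp}(G_2).$$
   Context: All graphs are finite, simple, undirected. For $S\subseteq V(G)$, $\overline{S}=V(G)\setminus S$ and $N(v)$ denotes the open neighbourhood of $v$. A set $S$ is a super dominating set of $G$ if every vertex of $\overline{S}$ has a neighbour in $S$ and for every $u\in\overline{S}$ there is $v\in S$ with $N(v)\cap\overline{S}=\{u\}$. The super domination number $\gamma_{sp}(G)$ is the minimum cardinality of a super dominating set of $G$. The Haj\'os sum $G_1(x_1y_1)+_H G_2(x_2y_2)$ is obtained from the disjoint union $(V_1\cup V_2,E_1\cup E_2)$ by deleting the edges $x_1y_1$ and $x_2y_2$, identifying the vertices $x_1$ and $x_2$ into a single vertex, and adding the edge $y_1y_2$. *)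

(* Defs.v *)
From mathcomp Require Import all_boot.

Set Implicit Arguments.
Unset Strict Implicit.
Unset Printing Implicit Defensive.

Record sgraph := SGraph {
  vertex :> finType;
  adj : rel vertex;
  adj_sym : symmetric adj;
  adj_irr : irreflexive adj }.

Notation "x -- y" := (adj x y) (at level 30).

Definition nbhd (G : sgraph) (v : G) : {set G} := [set u | v -- u].

Definition super_dominating (G : sgraph) (S : {set G}) : bool :=
  [forall u in ~: S, exists v in S, u -- v] &&
  [forall u in ~: S, exists v in S, nbhd v :&: ~: S == [set u]].

Lemma super_dominatingT (G : sgraph) : super_dominating [set: G].
Proof.
by apply/andP; split; apply/forallP => u; rewrite setCT in_set0.
Qed.

(* The default [set: G] is itself super dominating, so this is a genuine
   minimum over the super dominating sets. *)
Definition super_domination_number (G : sgraph) : nat :=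
  #|[arg min_(S < [set: G] | super_dominating S) #|S| ]|.

Section HajosSum.

Variables (G1 G2 : sgraph) (x1 y1 : G1) (x2 y2 : G2).

(* Disjoint union of G1 and G2 with the edges x1y1 and x2y2 deleted and the
   edge y1y2 added; x1 and x2 are not identified yet. *)
Definition hajos_split_adj : rel (G1 + G2) := fun p q =>
  match p, q with
  | inl a, inl b => (a -- b) && ([set a; b] != [set x1; y1])
  | inr a, inr b => (a -- b) && ([set a; b] != [set x2; y2])
  | inl a, inr b => (a == y1) && (b == y2)
  | inr b, inl a => (a == y1) && (b == y2)
  end.

(* The quotient of V1 + V2 identifying x1 with x2 is represented by
   V1 + (V2 \ {x2}): the merged vertex is [inl x1]. *)
Definition hajos_vertex : finType := (G1 + {b : G2 | b != x2})%type.

Definition hajos_proj (p : G1 + G2) : hajos_vertex :=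
  match p with
  | inl a => inl a
  | inr b => if insub b is Some b' then inr b' else inl x1
  end.

Definition hajos_adj : rel hajos_vertex := fun u v =>
  [exists p, exists q,
     [&& hajos_proj p == u, hajos_proj q == v & hajos_split_adj p q]].

Lemma hajos_adj_sym : symmetric hajos_adj.
Proof.
have split_sym p q : hajos_split_adj p q = hajos_split_adj q p.
  by case: p q => [a|a] [b|b] //=; rewrite adj_sym setUC.
have impl u v : hajos_adj u v -> hajos_adj v u.
  move=> /existsP[p /existsP[q /and3P[pu qv pq]]].
  apply/existsP; exists q; apply/existsP; exists p.
  by rewrite pu qv split_sym pq.
by move=> u v; apply/idP/idP; apply: impl.
Qed.

Lemma hajos_adj_irr : x2 -- y2 -> irreflexive hajos_adj.
Proof.
move=> x2y2 u; apply/negbTE/negP => /existsP[p /existsP[q /and3P[/eqP pu /eqP qu]]].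
have y2x2 : y2 != x2.
  by apply/eqP => y2E; rewrite y2E adj_irr in x2y2.
move: pu; rewrite -{u}qu.
case: p q => [a|a] [b|b] /=.
- by case=> ->; rewrite adj_irr.
- move=> + /andP[_ /eqP bE]; rewrite bE.
  by case: insubP => [b' _ _ //|]; rewrite y2x2.
- move=> + /andP[_ /eqP aE]; rewrite aE.
  by case: insubP => [a' _ _ //|]; rewrite y2x2.
- case: insubP => [a' _ <-|/negPn/eqP->]; case: insubP => [b' _ <-|/negPn/eqP->] //.
  + by case=> ->; rewrite adj_irr.
  + by rewrite adj_irr.
Qed.

(* G1(x1y1) +_H G2(x2y2) *)
Definition hajos_sum (e1 : x1 -- y1) (e2 : x2 -- y2) : sgraph :=
  SGraph hajos_adj_sym (hajos_adj_irr e2).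

End HajosSum.

(* Main.v *)
(** If [D] is the complement of a super dominating set, choosing for each [u]
    in [D] a vertex [v] with [N(v)] meeting [D] only in [u] gives a set of
    edges [(u, v)] such that the only edges between the chosen [u]'s and the
    chosen [v]'s are the pairs themselves.  Hence [#|G|] minus the super
    domination number of [G] is the maximal size [m(G)] of such a set, a notion
    that is symmetric in the two sides.  As the Hajós sum has
    [#|G1| + #|G2| - 1] vertices, the theorem says that
    [m(G1) + m(G2) - 1 <= m(G3) <= m(G1) + m(G2) + 1].  Both bounds come from
    gluing or restricting such sets, where exchanging the two sides in one
    summand and giving up one pair at the merged vertex (lower bound) or at
    [y1] or [y2] (upper bound) removes every conflict. *)
Require Import Defs.
From mathcomp Require Import all_boot zify.

Set Implicit Arguments.
Unset Strict Implicit.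
Unset Printing Implicit Defensive.

(** Pairs are oriented and only edges between the two sides are constrained: edges inside one side
    are allowed, unlike in a usual induced matching. The case [p = q] makes each pair an edge. *)
Definition induced_matching (G : sgraph) (M : {set G * G}) : Prop :=
  forall p q, p \in M -> q \in M ->
    p.1 != q.2 /\ (p.1 -- q.2) = (p == q).

Definition swap (T : Type) (p : T * T) : T * T := (p.2, p.1).

Definition touches (T : eqType) (v : T) (p : T * T) : bool :=
  (p.1 == v) || (p.2 == v).

Lemma adj_neq (G : sgraph) (u v : G) : u -- v -> u != v.
Proof. by apply: contraTneq => ->; rewrite adj_irr. Qed.

(** * Matchings and their relation to super domination *)

Section InducedMatching.

Variable G : sgraph.
Implicit Types (M A B : {set G * G}) (p q : G * G) (S : {set G}).

Lemma induced_matchingS A B :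
  A \subset B -> induced_matching B -> induced_matching A.
Proof. by move=> /subsetP sAB vB p q /sAB pB /sAB; apply: vB. Qed.

Lemma induced_matching_edge M p : induced_matching M -> p \in M -> p.1 -- p.2.
Proof. by move=> vM pM; have [_ ->] := vM p p pM pM. Qed.

Lemma induced_matching_fst_inj M :
  induced_matching M -> {in M &, injective (fun p : G * G => p.1)}.
Proof.
move=> vM p q pM qM /= pq; apply/eqP.
by have [_ <-] := vM p q pM qM; rewrite pq (induced_matching_edge vM).
Qed.

Lemma induced_matching_snd_inj M :
  induced_matching M -> {in M &, injective (fun p : G * G => p.2)}.
Proof.
move=> vM p q pM qM /= pq; apply/eqP.
by have [_ <-] := vM p q pM qM; rewrite -pq (induced_matching_edge vM).
Qed.

(** Each side determines the pair, and the mixed cases are impossible because the two sides are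
    disjoint. *)
Lemma induced_matching_touch_inj M v p q :
  induced_matching M -> p \in M -> q \in M ->
  touches v p -> touches v q -> p = q.
Proof.
move=> vM pM qM /orP[]/eqP pv /orP[]/eqP qv.
- by apply: (induced_matching_fst_inj vM) => //; rewrite pv qv.
- by have [/eqP[]] := vM p q pM qM; rewrite pv qv.
- by have [/eqP[]] := vM q p qM pM; rewrite pv qv.
- by apply: (induced_matching_snd_inj vM) => //; rewrite pv qv.
Qed.

Lemma card_touch_le1 M v :
  induced_matching M -> #|[set p in M | touches v p]| <= 1.
Proof.
move=> vM; apply/card_le1_eqP => p q; rewrite !inE => /andP[pM pv] /andP[qM qv].
exact: (induced_matching_touch_inj vM qM pM qv pv).
Qed.

Lemma swapK : involutive (@swap G).
Proof. by case. Qed.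

Lemma mem_swap M p : (p \in @swap G @: M) = (swap p \in M).
Proof. by rewrite -{1}(swapK p) (mem_imset _ _ (can_inj swapK)). Qed.

Lemma card_swap M : #|@swap G @: M| = #|M|.
Proof. exact: card_imset (can_inj swapK). Qed.

Lemma induced_matching_swap M :
  induced_matching M -> induced_matching (@swap G @: M).
Proof.
move=> vM p q; rewrite !mem_swap => pM qM.
have [] := vM _ _ qM pM; rewrite /swap /= => ne eadj.
rewrite eq_sym adj_sym eadj; split=> //.
by apply/eqP/eqP => [[]|->//]; case: p q {pM qM ne eadj} => ? ? [? ?] /= -> ->.
Qed.

(** Disjointness of [A] and [B] follows from the cross condition: a common pair would be an edge
    that the condition forbids. *)
Lemma induced_matchingU A B :
  induced_matching A -> induced_matching B ->
  (forall p q, p \in A -> q \in B ->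
    [/\ p.1 != q.2, q.1 != p.2, ~~ (p.1 -- q.2) & ~~ (q.1 -- p.2)]) ->
  induced_matching (A :|: B) /\ #|A :|: B| = #|A| + #|B|.
Proof.
move=> vA vB AB.
have disj p : p \in A -> p \in B -> False.
  move=> pA pB; have [_ _ /negP[]] := AB p p pA pB.
  by rewrite (induced_matching_edge vA).
split; last first.
  rewrite cardsU; suff -> : A :&: B = set0 by rewrite cards0 subn0.
  apply/setP => p; rewrite !inE; apply/negP => /andP[]; exact: disj.
move=> p q; rewrite !inE => /orP[] pM /orP[] qM; [exact: vA | | | exact: vB].
- have [ne1 _ /negbTE -> _] := AB p q pM qM; split=> //.
  by apply/esym/eqP => pq; apply: (disj p) => //; rewrite pq.
- have [_ ne1 _ /negbTE ->] := AB q p qM pM; split=> //.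
  by apply/esym/eqP => pq; apply: (disj q) => //; rewrite -pq.
Qed.

(** All pairs are swapped at once, since flipping a single pair could create edges between the
    sides. *)
Lemma exists_orient M v p :
  induced_matching M -> p \in M -> touches v p ->
  exists N f, [/\ induced_matching N, (v, f) \in N & #|N| = #|M|].
Proof.
move=> vM pM /orP[]/eqP pv.
  by exists M, p.2; split; rewrite // -pv -surjective_pairing.
exists (@swap G @: M), p.1; split; first exact: induced_matching_swap.
  by rewrite mem_swap /swap /= -pv -surjective_pairing.
exact: card_swap.
Qed.

Lemma exists_untouch M v :
  induced_matching M -> exists N : {set G * G},
    [/\ induced_matching N, forall p, p \in N -> ~~ touches v p & #|M| <= #|N|.+1].
Proof.
move=> vM; exists (M :\: [set p in M | touches v p]); split.
- by apply: induced_matchingS vM; exact: subsetDl.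
- by move=> p; rewrite !inE negb_and => /andP[/orP[/negbTE ->|]].
- rewrite -(cardsID [set p in M | touches v p] M) -add1n leq_add2r.
  apply: leq_trans (card_touch_le1 v vM).
  exact/subset_leq_card/subsetIr.
Qed.

Lemma super_domination_number_le S :
  super_dominating S -> super_domination_number G <= #|S|.
Proof.
rewrite /super_domination_number; case: arg_minnP => [|S0 _]; last exact.
exact: super_dominatingT.
Qed.

(** The complement of the set of first components is super dominating: [p.2] is the witness for
    [p.1]. *)
Lemma induced_matching_le M :
  induced_matching M -> #|M| + super_domination_number G <= #|G|.
Proof.
move=> vM; pose D := [set p.1 | p in M].
have cD : #|D| = #|M| by apply: card_in_imset; exact: induced_matching_fst_inj.
rewrite -cD -(cardsC D) leq_add2l; apply: super_domination_number_le.
have notD p : p \in M -> p.2 \in ~: D.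
  move=> pM; rewrite inE; apply/imsetP => -[q qM pq].
  by have [/eqP[]] := vM q p qM pM.
apply/andP; split; apply/forall_inP => u;
  rewrite setCK => /imsetP[p pM ->]; apply/existsP; exists p.2;
  rewrite notD //=; first exact: induced_matching_edge vM pM.
apply/eqP/setP => w; rewrite !inE adj_sym.
apply/andP/eqP => [[wp /imsetP[q qM wq]]|->].
  by move: wp; rewrite wq; have [_ ->] := vM q p qM pM => /eqP ->.
by rewrite (induced_matching_edge vM pM); split=> //; apply: imset_f.
Qed.

Lemma induced_matching_max :
  exists2 M : {set G * G}, induced_matching M & #|M| + super_domination_number G = #|G|.
Proof.
rewrite /super_domination_number; case: arg_minnP => [|S].
  exact: super_dominatingT.
move=> /andP[_ /forall_inP dom] _.
(* The default [u] is never reached when [u] lies outside [S], because [S] is super dominating. *)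
pose f u := odflt u [pick v in S | nbhd v :&: ~: S == [set u]].
have fP u : u \in ~: S -> f u \in S /\ nbhd (f u) :&: ~: S = [set u].
  move=> uS; rewrite /f; case: pickP => [v /andP[vS /eqP]//|none].
  by have /existsP[v] := dom u uS; rewrite none.
exists [set (u, f u) | u in ~: S].
  move=> _ _ /imsetP[u uS ->] /imsetP[w wS ->] /=.
  have [fS fE] := fP w wS.
  split; first by apply: contraTneq uS => ->; rewrite inE fS.
  have := in_set1 u w; rewrite -fE 2!inE uS andbT adj_sym => ->.
  by apply/eqP/eqP => [->|[]].
rewrite card_imset => [|u w []//].
by rewrite addnC cardsC.
Qed.

End InducedMatching.

(* A symmetric presentation of the Hajós sum: it can be read with the two
   summands exchanged, which the quotient [V1 + (V2 \ {x2})] does not allow. *)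
Record hajos_embedding (G1 G2 G3 : sgraph) (x1 y1 : G1) (x2 y2 : G2)
    (i1 : G1 -> G3) (i2 : G2 -> G3) : Prop := HajosEmbedding {
  hajos_edge1 : x1 -- y1;
  hajos_edge2 : x2 -- y2;
  hajos_inj1 : injective i1;
  hajos_inj2 : injective i2;
  hajos_glue : i1 x1 = i2 x2;
  hajos_meet : forall a b, i1 a = i2 b -> a = x1 /\ b = x2;
  hajos_cover : forall v, (exists a, v = i1 a) \/ (exists b, v = i2 b);
  hajos_adj1 : forall a b,
    (i1 a -- i1 b) = (a -- b) && ~~ (touches x1 (a, b) && touches y1 (a, b));
  hajos_adj2 : forall a b,
    (i2 a -- i2 b) = (a -- b) && ~~ (touches x2 (a, b) && touches y2 (a, b));
  hajos_cross : forall a b, a != x1 -> b != x2 ->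
    (i1 a -- i2 b) = (a == y1) && (b == y2) }.

Lemma hajos_embeddingC (G1 G2 G3 : sgraph) (x1 y1 : G1) (x2 y2 : G2)
    (i1 : G1 -> G3) (i2 : G2 -> G3) :
  hajos_embedding x1 y1 x2 y2 i1 i2 -> hajos_embedding x2 y2 x1 y1 i2 i1.
Proof.
case=> e1 e2 j1 j2 gl mt cv a1 a2 cr; split=> //.
- by move=> a b /esym /mt[].
- by move=> v; case: (cv v); [right | left].
- by move=> a b ax bx; rewrite adj_sym cr // andbC.
Qed.

(** * Transport of matchings along vertex injections *)

Section Push.

Variables (G G' : sgraph) (i : G -> G').

Definition pair_map (p : G * G) : G' * G' := (i p.1, i p.2).

Lemma card_pair_map (M : {set G * G}) : injective i -> #|pair_map @: M| = #|M|.
Proof. by move=> ij; apply: card_imset => -[? ?] [? ?] [/ij -> /ij ->]. Qed.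

Lemma induced_matching_push (M : {set G * G}) : injective i ->
  (forall p q, p \in M -> q \in M -> (i p.1 -- i q.2) = (p.1 -- q.2)) ->
  induced_matching M -> induced_matching (pair_map @: M).
Proof.
move=> ij ia vM _ _ /imsetP[p pM ->] /imsetP[q qM ->] /=.
have [ne eadj] := vM p q pM qM; rewrite ia // eadj (inj_eq ij); split=> //.
by apply/eqP/eqP => [->//|[/ij pq1 /ij pq2]]; case: p q pq1 pq2 {pM qM ne eadj}
  => ? ? [? ?] /= -> ->.
Qed.

Lemma induced_matching_pull (M : {set G' * G'}) (A : {set G * G}) :
  injective i -> induced_matching M ->
  (forall p, p \in A -> pair_map p \in M) ->
  (forall p q, p \in A -> q \in A -> (i p.1 -- i q.2) = (p.1 -- q.2)) ->
  induced_matching A.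
Proof.
move=> ij vM AM ia p q pA qA.
have [/= ne eadj] := vM _ _ (AM p pA) (AM q qA).
rewrite -(inj_eq ij) -ia // eadj; split=> //.
by apply/eqP/eqP => [[/ij pq1 /ij pq2]|->//]; case: p q pq1 pq2 {pA qA ne eadj}
  => ? ? [? ?] /= -> ->.
Qed.

End Push.

(** * Gluing and restricting matchings in a Hajós sum *)

Section Sum.

Variables (G1 G2 G3 : sgraph) (x1 y1 : G1) (x2 y2 : G2).
Variables (i1 : G1 -> G3) (i2 : G2 -> G3).
Hypothesis H : hajos_embedding x1 y1 x2 y2 i1 i2.

Lemma hajos_ne a b : a != x1 -> i1 a != i2 b.
Proof. by apply: contraNneq => /(hajos_meet H)[->]. Qed.

(* The edge [x1y1] is the only one on which [i1] does not preserve adjacency. *)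
Lemma induced_matching_push1 (M : {set G1 * G1}) :
  (forall p, p \in M -> ~~ (touches x1 p && touches y1 p)) ->
  induced_matching M -> induced_matching (pair_map i1 @: M).
Proof.
move=> avoid vM; apply: (induced_matching_push (hajos_inj1 H) _ vM) => p q pM qM.
rewrite (hajos_adj1 H); have [_ ->] := vM p q pM qM.
by case: eqP => //= <-; rewrite -surjective_pairing avoid.
Qed.

(** With the merged vertex avoided, the only possible edge between the two images is [y1y2]; the
    last hypothesis keeps its ends from lying on opposite sides. *)
Lemma glue_untouched (M1 : {set G1 * G1}) (M2 : {set G2 * G2}) :
  induced_matching M1 -> induced_matching M2 ->
  (forall p, p \in M1 -> ~~ touches x1 p) ->
  (forall p, p \in M2 -> ~~ touches x2 p) ->
  (forall p q, p \in M1 -> q \in M2 ->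
     ~~ ((p.1 == y1) && (q.2 == y2)) /\ ~~ ((p.2 == y1) && (q.1 == y2))) ->
  induced_matching (pair_map i1 @: M1 :|: pair_map i2 @: M2) /\
  #|pair_map i1 @: M1 :|: pair_map i2 @: M2| = #|M1| + #|M2|.
Proof.
move=> v1 v2 u1 u2 cr.
rewrite -(card_pair_map M1 (hajos_inj1 H)) -(card_pair_map M2 (hajos_inj2 H)).
apply: induced_matchingU.
- by apply: induced_matching_push1 => // p /u1 /negbTE ->.
- apply: (induced_matching_push (hajos_inj2 H) _ v2) => p q pM qM.
  rewrite (hajos_adj2 H); have [_ ->] := v2 p q pM qM.
  by case: eqP => //= <-; rewrite -surjective_pairing (negbTE (u2 p pM)).
move=> _ _ /imsetP[p pM ->] /imsetP[q qM ->] /=.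
have /norP[p1 p2] := u1 p pM; have /norP[q1 q2] := u2 q qM.
have [c1 c2] := cr p q pM qM.
split; first exact: hajos_ne; first by rewrite eq_sym hajos_ne.
- by rewrite (hajos_cross H).
- by rewrite adj_sym (hajos_cross H).
Qed.

(** If [y1] and [y2] lie on opposite sides, swapping [M2] puts them on the same side, where their
    edge is allowed. *)
Lemma exists_glue_untouched (M1 : {set G1 * G1}) (M2 : {set G2 * G2}) :
  induced_matching M1 -> induced_matching M2 ->
  (forall p, p \in M1 -> ~~ touches x1 p) ->
  (forall p, p \in M2 -> ~~ touches x2 p) ->
  exists2 M : {set G3 * G3}, induced_matching M & #|M| = #|M1| + #|M2|.
Proof.
move=> v1 v2 u1 u2.
have good (N : {set G2 * G2}) : induced_matching N ->
    (forall p, p \in N -> ~~ touches x2 p) ->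
    (forall p q, p \in M1 -> q \in N ->
     ~~ ((p.1 == y1) && (q.2 == y2)) /\ ~~ ((p.2 == y1) && (q.1 == y2))) ->
    exists2 M : {set G3 * G3}, induced_matching M & #|M| = #|M1| + #|N|.
  by move=> vN uN cr; have [vM cM] := glue_untouched v1 vN u1 uN cr; eexists; eauto.
case: (boolP [forall p in M1, forall q in M2,
   ~~ ((p.1 == y1) && (q.2 == y2)) && ~~ ((p.2 == y1) && (q.1 == y2))]).
  move=> /forall_inP cr; apply: good => // p q pM qM.
  by apply/andP; apply: (forall_inP (cr p pM)).
move=> /forall_inPn[p pM /forall_inPn[q qM]]; rewrite negb_and !negbK => pq.
rewrite -(card_swap M2); apply: good; first exact: induced_matching_swap.
  by move=> r; rewrite mem_swap => /u2; rewrite /touches orbC.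
move=> r s rM; rewrite mem_swap => sM.
have [/eqP rp2 _] := v1 r p rM pM; have [/eqP pr2 _] := v1 p r pM rM.
have [/eqP sq2 _] := v2 _ q sM qM; have [/eqP qs2 _] := v2 q _ qM sM.
rewrite /= in sq2 qs2.
by case/orP: pq => /andP[/eqP E1 /eqP E2]; split; apply/negP => /andP[/eqP F1 /eqP F2];
  congruence.
Qed.

(* [x] keeps the partner it has in [G2] and loses the one it has in [G1]. *)
Lemma glue_touched (M1 : {set G1 * G1}) (M2 : {set G2 * G2}) f1 f2 :
  induced_matching M1 -> induced_matching M2 ->
  (x1, f1) \in M1 -> (x2, f2) \in M2 -> f2 != y2 ->
  exists2 M : {set G3 * G3}, induced_matching M & #|M|.+1 = #|M1| + #|M2|.
Proof.
move=> v1 v2 m1 m2 f2y; pose N1 := M1 :\ (x1, f1).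
have vN1 : induced_matching N1 by apply: induced_matchingS v1; exact: subD1set.
have u1 p : p \in N1 -> ~~ touches x1 p.
  rewrite inE in_set1 => /andP[ne pM]; apply: contraNN ne => px; apply/eqP.
  by apply: (induced_matching_touch_inj v1 pM m1 px); rewrite /touches eqxx.
(* As the partner of [x1] is gone, no remaining second component is adjacent to [x1]; in particular
   none is [y1]. *)
have x1p p : p \in N1 -> ~~ (x1 -- p.2).
  by rewrite inE in_set1 eq_sym => /andP[ne pM]; have [_ /= ->] := v1 _ _ m1 pM.
have u2 p : p \in M2 -> ~~ (touches x2 p && touches y2 p).
  move=> pM; apply/negP => /andP[px py].
  have pE := induced_matching_touch_inj v2 pM m2 px.
  move: py; rewrite pE /touches /= ?eqxx // (negbTE f2y) orbF => /eqP xy.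
  by have := adj_neq (hajos_edge2 H); rewrite xy eqxx.
(* A second component equal to [y2] would be adjacent to [x2], hence would be its partner [f2]. *)
have y2p p : p \in M2 -> p.2 != y2.
  move=> pM; apply/negP => /eqP py; have [_ /=] := v2 _ _ m2 pM.
  rewrite py (hajos_edge2 H) => /esym/eqP pE.
  by rewrite -py -pE eqxx in f2y.
have [||| vM cM] := @induced_matchingU _ (pair_map i1 @: N1) (pair_map i2 @: M2).
- by apply: induced_matching_push1 => // p /u1 /negbTE ->.
- apply: (induced_matching_push (hajos_inj2 H) _ v2) => p q pM qM.
  rewrite (hajos_adj2 H); have [_ ->] := v2 p q pM qM.
  by case: eqP => //= <-; rewrite -surjective_pairing u2.
- move=> _ _ /imsetP[p pM ->] /imsetP[q qM ->] /=.
  have /norP[p1 p2] := u1 p pM.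
  split; first exact: hajos_ne; first by rewrite eq_sym hajos_ne.
  + have q2x : q.2 != x2 by have [/= + _] := v2 _ _ m2 qM; rewrite eq_sym.
    by rewrite (hajos_cross H) // (negbTE (y2p q qM)) andbF.
  + have [->|q1x] := eqVneq q.1 x2.
      by rewrite -(hajos_glue H) (hajos_adj1 H) negb_and x1p.
    rewrite adj_sym (hajos_cross H) // negb_and.
    by apply/orP; left; apply: contraTneq (hajos_edge1 H) => <-; exact: x1p.
exists (pair_map i1 @: N1 :|: pair_map i2 @: M2) => //.
rewrite cM (card_pair_map _ (hajos_inj1 H)) (card_pair_map _ (hajos_inj2 H)).
by rewrite (cardsD1 (x1, f1) M1) m1.
Qed.

(* The pairs [x1y1] and [x2y2] are both traded for the new edge [y1y2]. *)
Lemma glue_edges (M1 : {set G1 * G1}) (M2 : {set G2 * G2}) :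
  induced_matching M1 -> induced_matching M2 ->
  (x1, y1) \in M1 -> (y2, x2) \in M2 ->
  exists2 M : {set G3 * G3}, induced_matching M & #|M|.+1 = #|M1| + #|M2|.
Proof.
move=> v1 v2 m1 m2; pose N1 := M1 :\ (x1, y1); pose N2 := M2 :\ (y2, x2).
have vN1 : induced_matching N1 by apply: induced_matchingS v1; exact: subD1set.
have vN2 : induced_matching N2 by apply: induced_matchingS v2; exact: subD1set.
have u1 p v : touches v (x1, y1) -> p \in N1 -> ~~ touches v p.
  rewrite inE in_set1 => vx /andP[ne pM]; apply: contraNN ne => px; apply/eqP.
  exact: (induced_matching_touch_inj v1 pM m1 px).
have u2 p v : touches v (y2, x2) -> p \in N2 -> ~~ touches v p.
  rewrite inE in_set1 => vx /andP[ne pM]; apply: contraNN ne => px; apply/eqP.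
  exact: (induced_matching_touch_inj v2 pM m2 px).
have tx1 : touches x1 (x1, y1) by rewrite /touches eqxx.
have ty1 : touches y1 (x1, y1) by rewrite /touches eqxx orbT.
have tx2 : touches x2 (y2, x2) by rewrite /touches eqxx orbT.
have ty2 : touches y2 (y2, x2) by rewrite /touches eqxx.
have y1x1 : y1 != x1 by rewrite eq_sym (adj_neq (hajos_edge1 H)).
have y2x2 : y2 != x2 by rewrite eq_sym (adj_neq (hajos_edge2 H)).
have [vN cN] : induced_matching (pair_map i1 @: N1 :|: pair_map i2 @: N2) /\
  #|pair_map i1 @: N1 :|: pair_map i2 @: N2| = #|N1| + #|N2|.
  apply: glue_untouched => //; [by move=> p; exact: u1 | by move=> p; exact: u2 |].
  by move=> p q /(u1 _ _ ty1)/norP[/negbTE -> /negbTE ->].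
have y12 : i2 y2 -- i1 y1 by rewrite adj_sym (hajos_cross H) // !eqxx.
(* The opposite orientations of the two traded pairs let [y2] stay first and [y1] stay second, so
   non-adjacency to the remaining pairs is inherited from [M2] and [M1]. *)
have [|| vM cM] := @induced_matchingU _ [set (i2 y2, i1 y1)] _ _ vN.
- move=> p q; rewrite !in_set1 => /eqP -> /eqP -> /=.
  by rewrite y12 eqxx eq_sym hajos_ne.
- move=> _ q /set1P -> /setUP[] /imsetP[{}q qM ->] /=.
  + have /norP[q1x q2x] := u1 _ _ tx1 qM; have /norP[q1y q2y] := u1 _ _ ty1 qM.
    rewrite eq_sym hajos_ne // (inj_eq (hajos_inj1 H)) q1y; split=> //.
      by rewrite adj_sym (hajos_cross H) // (negbTE q2y).
    rewrite (hajos_adj1 H) negb_and.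
    have qM1 : q \in M1 by move: qM; rewrite inE => /andP[].
    have [_ /= ->] := v1 _ _ qM1 m1.
    by apply/orP; left; move: qM; rewrite !inE => /andP[].
  + have /norP[q1x q2x] := u2 _ _ tx2 qM; have /norP[q1y q2y] := u2 _ _ ty2 qM.
    rewrite (inj_eq (hajos_inj2 H)) (eq_sym y2) q2y [i2 _ == _]eq_sym hajos_ne //.
    split=> //; last by rewrite adj_sym (hajos_cross H) // (negbTE q1y) andbF.
    rewrite (hajos_adj2 H) negb_and.
    have qM2 : q \in M2 by move: qM; rewrite inE => /andP[].
    have [_ /= ->] := v2 _ _ m2 qM2.
    by apply/orP; left; move: qM; rewrite !inE eq_sym => /andP[].
exists ([set (i2 y2, i1 y1)] :|: (pair_map i1 @: N1 :|: pair_map i2 @: N2)) => //.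
by rewrite cM cN cards1 (cardsD1 (x1, y1) M1) (cardsD1 (y2, x2) M2) m1 m2 !add1n addnS.
Qed.

(* Restricting to pairs off [y1] makes the edge [x1y1] harmless in [G1]; in
   [G2] the edge [x2y2] is harmless because [x2] is not touched. *)
Lemma restrict_matching (M : {set G3 * G3}) :
  induced_matching M ->
  (forall p, pair_map i2 p \in M -> ~~ touches x2 p) ->
  exists M1 M2, [/\ @induced_matching G1 M1, @induced_matching G2 M2 &
    #|M| <= (#|M1| + #|M2|).+1].
Proof.
move=> vM u2.
pose M1 := [set p | (pair_map i1 p \in M) && ~~ touches y1 p].
pose M2 := [set p | pair_map i2 p \in M].
exists M1, M2; split.
- apply: (induced_matching_pull (hajos_inj1 H) vM _ _) => [p|p q].
    by rewrite inE => /andP[].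
  rewrite !inE => /andP[_ /norP[p1 _]] /andP[_ /norP[_ q2]].
  by rewrite (hajos_adj1 H) [touches y1 _]/touches /= (negbTE p1) (negbTE q2) andbF andbT.
- apply: (induced_matching_pull (hajos_inj2 H) vM _ _) => [p|p q].
    by rewrite inE.
  rewrite !inE => /u2/norP[p1 _] /u2/norP[_ q2].
  by rewrite (hajos_adj2 H) [touches x2 _]/touches /= (negbTE p1) (negbTE q2) andbT.
(* A pair off [y1] lies within one summand; the at most one pair through [y1] accounts for the
   successor in the bound. *)
have sub : M \subset [set p in M | touches (i1 y1) p]
      :|: (pair_map i1 @: M1 :|: pair_map i2 @: M2).
  apply/subsetP => -[u v] pM; rewrite in_setU inE pM /= in_setU.
  have [//|ny] := boolP (touches (i1 y1) (u, v)).
  have uv : u -- v := induced_matching_edge vM pM.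
  have in1 a b : (u, v) = (i1 a, i1 b) -> (u, v) \in pair_map i1 @: M1.
    move=> E; apply/imsetP; exists (a, b) => //.
    rewrite inE /pair_map /= -E pM /=; apply: contraNN ny; rewrite E.
    by rewrite /touches /= !(inj_eq (hajos_inj1 H)).
  have in2 a b : (u, v) = (i2 a, i2 b) -> (u, v) \in pair_map i2 @: M2.
    by move=> E; apply/imsetP; exists (a, b) => //; rewrite inE /pair_map /= -E.
  move: uv ny; rewrite /touches /=.
  case: (hajos_cover H u) => [[a ua]|[b ub]];
    case: (hajos_cover H v) => [[c vc]|[d vd]].
  + by rewrite (in1 a c) ?ua ?vc.
  (* An edge with ends taken from different summands either uses the merged vertex, and so lies in
     one summand, or is [y1y2], which touches [y1]. *)
  + have [ax|ax] := eqVneq a x1.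
      by rewrite (in2 x2 d) ?orbT // ua vd ax (hajos_glue H).
    have [dx|dx] := eqVneq d x2.
      by rewrite (in1 a x1) // ua vd dx (hajos_glue H).
    by rewrite ua vd (hajos_cross H) // => /andP[/eqP -> _]; rewrite eqxx.
  + have [cx|cx] := eqVneq c x1.
      by rewrite (in2 b x2) ?orbT // ub vc cx (hajos_glue H).
    have [bx|bx] := eqVneq b x2.
      by rewrite (in1 x1 c) // ub vc bx (hajos_glue H).
    by rewrite ub vc adj_sym (hajos_cross H) // => /andP[/eqP -> _]; rewrite eqxx orbT.
  + by rewrite (in2 b d) ?ub ?vd ?orbT.
apply: leq_trans (subset_leq_card sub) _.
apply: leq_trans (leq_card_setU _ _) _; rewrite -add1n.
apply: leq_add; first exact: card_touch_le1.
apply: leq_trans (leq_card_setU _ _) _.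
by rewrite (card_pair_map _ (hajos_inj1 H)) (card_pair_map _ (hajos_inj2 H)).
Qed.

End Sum.

(** * Both bounds on matching sizes *)

Section Bounds.

Variables (G1 G2 G3 : sgraph) (x1 y1 : G1) (x2 y2 : G2).
Variables (i1 : G1 -> G3) (i2 : G2 -> G3).
Hypothesis H : hajos_embedding x1 y1 x2 y2 i1 i2.

(** At most one pair passes through the merged vertex, so in one summand no pair touches it; the
    summands are exchanged if that one is [G1]. *)
Lemma exists_restrict (M : {set G3 * G3}) :
  induced_matching M ->
  exists M1 M2, [/\ @induced_matching G1 M1, @induced_matching G2 M2 &
    #|M| <= (#|M1| + #|M2|).+1].
Proof.
move=> vM.
case: (boolP [forall p, (pair_map i2 p \in M) ==> ~~ touches x2 p]) => [/forallP u2|].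
  by apply: (restrict_matching H vM) => p; apply/implyP.
move=> /forallPn[q]; rewrite negb_imply negbK => /andP[qM qx].
have [p pM|M2 [M1 [v2 v1 le]]] := restrict_matching (hajos_embeddingC H) vM.
  apply/negP => px.
  (* Pairs from both summands at the merged vertex would coincide, and the common pair would be a
     loop there. *)
  have E : pair_map i1 p = pair_map i2 q.
    apply: (@induced_matching_touch_inj _ _ (i1 x1) _ _ vM pM qM).
      by rewrite /touches /= !(inj_eq (hajos_inj1 H)).
    by rewrite /touches /= (hajos_glue H) !(inj_eq (hajos_inj2 H)).
  have := induced_matching_edge vM pM.
  case: E => /(hajos_meet H)[E1 _] /(hajos_meet H)[E2 _].
  by rewrite /= E1 E2 adj_irr.
by exists M1, M2; rewrite addnC.
Qed.

(** If one matching misses its [x], the other gives up its pair there. Otherwise both are oriented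
    with [x] first: either some partner differs from the corresponding [y], or both pairs are the
    deleted edges. *)
Lemma exists_glue (M1 : {set G1 * G1}) (M2 : {set G2 * G2}) :
  induced_matching M1 -> induced_matching M2 ->
  exists2 M : {set G3 * G3}, induced_matching M & #|M1| + #|M2| <= #|M|.+1.
Proof.
move=> v1 v2.
have [/exists_inP[p1 p1M p1x]|/exists_inPn u1] :=
    boolP [exists p in M1, touches x1 p]; last first.
  have [N2 [vN2 u2 c2]] := exists_untouch x2 v2.
  have [M vM cM] := exists_glue_untouched H v1 vN2 u1 u2.
  by exists M => //; lia.
have [/exists_inP[p2 p2M p2x]|/exists_inPn u2] :=
    boolP [exists p in M2, touches x2 p]; last first.
  have [N1 [vN1 u1 c1]] := exists_untouch x1 v1.
  have [M vM cM] := exists_glue_untouched H vN1 v2 u1 u2.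
  by exists M => //; lia.
have [N1 [f1 [vN1 m1 <-]]] := exists_orient v1 p1M p1x.
have [N2 [f2 [vN2 m2 <-]]] := exists_orient v2 p2M p2x.
have [E2|f2y] := eqVneq f2 y2; last first.
  by have [M vM cM] := glue_touched H vN1 vN2 m1 m2 f2y; exists M => //; rewrite cM.
have [E1|f1y] := eqVneq f1 y1; last first.
  have [M vM cM] := glue_touched (hajos_embeddingC H) vN2 vN1 m2 m1 f1y.
  by exists M => //; rewrite cM addnC.
rewrite E1 in m1; rewrite E2 in m2.
have m2' : (y2, x2) \in @swap G2 @: N2 by rewrite mem_swap.
have [M vM cM] := glue_edges H vN1 (induced_matching_swap vN2) m1 m2'.
by exists M => //; rewrite cM card_swap.
Qed.

End Bounds.

(** * The quotient as a model of the symmetric presentation *)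

Section HajosSumEmbedding.

Variables (G1 G2 : sgraph) (x1 y1 : G1) (x2 y2 : G2).
Hypotheses (e1 : x1 -- y1) (e2 : x2 -- y2).

Let proj := @hajos_proj G1 G2 x1 x2.

Lemma hajos_proj_eq p q : proj p = proj q ->
  [\/ p = q, p = inl x1 /\ q = inr x2 | p = inr x2 /\ q = inl x1].
Proof.
case: p q => [a|a] [b|b] /=.
- by case=> ->; constructor 1.
- by case: insubP => // /negPn/eqP -> [->]; constructor 2.
- by case: insubP => // /negPn/eqP -> [->]; constructor 3.
- case: insubP => [a' _ <-|/negPn/eqP->]; case: insubP => [b' _ <-|/negPn/eqP->] //.
  + by case=> ->; constructor 1.
  + by constructor 1.
Qed.

(** This translates the deleted edge from [hajos_split_adj] to [hajos_embedding]. If [c = d], the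
    right side would ask for one end only. *)
Lemma set2_eq_touches (T : finType) (a b c d : T) : c != d ->
  ([set a; b] == [set c; d]) = touches c (a, b) && touches d (a, b).
Proof.
move=> cd; rewrite /touches /=; apply/eqP/andP => [E|[]].
  have := set21 c d; have := set22 c d; rewrite -E !inE.
  by rewrite ![_ == a]eq_sym ![_ == b]eq_sym.
move=> /orP[]/eqP-> /orP[]/eqP E.
- by rewrite E eqxx in cd.
- by rewrite E.
- by rewrite E setUC.
- by rewrite E eqxx in cd.
Qed.

Lemma hajos_sum_adjE p q :
  (adj (s := hajos_sum e1 e2) (proj p) (proj q)) =
  [exists p', exists q', [&& proj p' == proj p, proj q' == proj q &
     hajos_split_adj x1 y1 x2 y2 p' q']].
Proof. by []. Qed.

Lemma hajos_sum_embedding :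
  @hajos_embedding G1 G2 (hajos_sum e1 e2) x1 y1 x2 y2
    (fun a => proj (inl a)) (fun b => proj (inr b)).
Proof.
have nx1 := adj_neq e1; have nx2 := adj_neq e2.
split=> //.
- by move=> a b [].
- by move=> a b /hajos_proj_eq[[]//|[]|[]].
- by rewrite /proj /= insubF ?eqxx.
- by move=> a b /hajos_proj_eq[|[[->] [->]]|[]].
- case=> [a|[b bx]]; [left; exists a | right; exists b] => //.
  by rewrite /proj /= insubT.
- move=> a b; rewrite hajos_sum_adjE -set2_eq_touches //; apply/idP/idP; last first.
    move=> ab; apply/existsP; exists (inl a); apply/existsP; exists (inl b).
    by rewrite !eqxx.
  (* The extra preimage [inr x2] of the merged vertex adds no edge here: a cross edge at it would
     force [x2 = y2], and using it twice gives a loop. *)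
  move=> /existsP[p /existsP[q /and3P[/eqP/hajos_proj_eq pa /eqP/hajos_proj_eq qb]]].
  case: pa => [->|[_ //]|[-> [->]]]; case: qb => [->|[_ //]|[-> [->]]] //=.
  + by rewrite (negbTE nx2) andbF.
  + by rewrite (negbTE nx2) andbF.
  + by rewrite adj_irr.
- move=> a b; rewrite hajos_sum_adjE -set2_eq_touches //; apply/idP/idP; last first.
    move=> ab; apply/existsP; exists (inr a); apply/existsP; exists (inr b).
    by rewrite !eqxx.
  move=> /existsP[p /existsP[q /and3P[/eqP/hajos_proj_eq pa /eqP/hajos_proj_eq qb]]].
  case: pa => [->|[-> [->]]|[_ //]]; case: qb => [->|[-> [->]]|[_ //]] //=.
  + by rewrite (negbTE nx1).
  + by rewrite (negbTE nx1).
  + by rewrite adj_irr.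
- move=> a b ax bx; rewrite hajos_sum_adjE; apply/idP/idP; last first.
    move=> ab; apply/existsP; exists (inl a); apply/existsP; exists (inr b).
    by rewrite !eqxx.
  move=> /existsP[p /existsP[q /and3P[/eqP/hajos_proj_eq pa /eqP/hajos_proj_eq qb]]].
  case: pa => [->|[_ //]|[_ [E]]]; last by rewrite E eqxx in ax.
  by case: qb => [->|[_ [E]]|[_ //]] //; rewrite E eqxx in bx.
Qed.

Lemma card_hajos_sum : #|hajos_sum e1 e2|.+1 = #|G1| + #|G2|.
Proof.
rewrite card_sum card_sig -addnS; congr (_ + _).
by rewrite (cardC1 x2) prednK //; apply/card_gt0P; exists x2.
Qed.

End HajosSumEmbedding.

Theorem theorem5p1 (G1 G2 : sgraph) (x1 y1 : G1) (x2 y2 : G2)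
    (e1 : x1 -- y1) (e2 : x2 -- y2) :
  super_domination_number G1 + super_domination_number G2 - 2
    <= super_domination_number (hajos_sum e1 e2)
    <= super_domination_number G1 + super_domination_number G2.
Proof.
have H := hajos_sum_embedding e1 e2; have n3 := card_hajos_sum e1 e2.
have [M1 v1 c1] := induced_matching_max G1.
have [M2 v2 c2] := induced_matching_max G2.
have [M3 v3 c3] := induced_matching_max (hajos_sum e1 e2).
have [N3 w3 d3] := exists_glue H v1 v2.
have [N1 [N2 [w1 w2 d]]] := exists_restrict H v3.
have l1 := induced_matching_le w1.
have l2 := induced_matching_le w2.
have l3 := induced_matching_le w3.
(* The vertex lost by merging cancels the pair lost in gluing; for the lower bound it adds to the
   pair lost in restricting, whence the 2. *)
by apply/andP; split; lia.
Qed.
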